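(* Let $D$ be a $w$-Hilbert domain. Then every $w$-G-ideal of $D$ is a maximal $w$-ideal of $D$.
   Context: Let $D$ be an integral domain with quotient field $K$. For a nonzero fractional ideal $I$ of $D$ put $I^{-1}=\{a\in K \mid aI\subseteq D\}$. A Glaz-Vasconcelos ideal (GV-ideal) of $D$ is a (nonzero) finitely generated ideal $J$ of $D$ with $J^{-1}=D$; the set of these is $\mathrm{GV}(D)$. The $w$-envelope of a nonzero fractional ideal $I$ is $I_w=\{a\in K \mid aJ\subseteq I \text{ for some } J\in \mathrm{GV}(D)\}$. An ideal $I$ of $D$ is a $w$-ideal if $I_w=I$; since the $w$-operation is defined only on nonzero fractional ideals, $w$-ideals are nonzero. A maximal $w$-ideal is a proper $w$-ideal that is not properly contained in any proper $w$-ideal. A prime $w$-ideal is an ideal that is both a prime ideal and a $w$-ideal (in particular, it is nonzero). $D$ is a $w$-Hilbert domain if every prime $w$-ideal of $D$ can be expressed as an intersection of maximal $w$-ideals of $D$. A G-domain is an integral domain whose quotient field is finitely generated as a ring over it (equivalently, the intersection of all its nonzero prime ideals is nonzero, where a field counts as a G-domain). A G-ideal of $D$ is a prime ideal $P$ such that $D/P$ is a G-domain. A $w$-G-ideal of $D$ is an ideal that is both a G-ideal and a $w$-ideal. *)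

(* Defs.v *)
From HB Require Import structures.
From mathcomp Require Import all_boot all_order all_algebra.
From mathcomp Require Import boolp classical_sets.

Set Implicit Arguments.
Unset Strict Implicit.
Unset Printing Implicit Defensive.

Import GRing.Theory.
Local Open Scope ring_scope.
Local Open Scope classical_set_scope.

(* [{ideal_quot P}] is only a [comNzRingType] in the library, because units of
   the quotient need not be decidable.  Classically every commutative ring is a
   unit ring, so for prime [P] the quotient becomes an [idomainType] and thus
   has a field of fractions. *)
Definition prime_quot (R : comNzRingType) (P : prime_idealr R) : Type :=
  {ideal_quot P}.

HB.instance Definition _ (R : comNzRingType) (P : prime_idealr R) :=
  GRing.ComNzRing.copy (prime_quot P) {ideal_quot P}.

Definition prime_quot_unit (R : comNzRingType) (P : prime_idealr R) :
    pred (prime_quot P) :=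
  fun x => `[< exists y, y * x = 1 >].

Definition prime_quot_inv (R : comNzRingType) (P : prime_idealr R)
    (x : prime_quot P) : prime_quot P :=
  if pselect (exists y, y * x = 1) is left e then projT1 (cid e) else x.

Lemma prime_quot_mulVx (R : comNzRingType) (P : prime_idealr R) :
  {in @prime_quot_unit R P, left_inverse 1 (@prime_quot_inv R P) *%R}.
Proof.
move=> x /asboolP ex; rewrite /prime_quot_inv.
by case: pselect => // e; case: (cid e).
Qed.

Lemma prime_quot_unitPl (R : comNzRingType) (P : prime_idealr R)
  (x y : prime_quot P) : y * x = 1 -> prime_quot_unit x.
Proof. by move=> yx; apply/asboolP; exists y. Qed.

Lemma prime_quot_invx_out (R : comNzRingType) (P : prime_idealr R) :
  {in [predC @prime_quot_unit R P], @prime_quot_inv R P =1 id}.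
Proof.
move=> x /negP xN; rewrite /prime_quot_inv.
by case: pselect => // e; case: xN; apply/asboolP.
Qed.

HB.instance Definition _ (R : comNzRingType) (P : prime_idealr R) :=
  GRing.ComNzRing_hasMulInverse.Build (prime_quot P)
    (@prime_quot_mulVx R P) (@prime_quot_unitPl R P) (@prime_quot_invx_out R P).

HB.instance Definition _ (R : comNzRingType) (P : prime_idealr R) :=
  GRing.ComUnitRing_isIntegral.Build (prime_quot P)
    (@Quotient.rquot_IdomainAxiom R P).

Notation tofrac := (@FracField.tofrac _).

(* [setT] is an ideal here, whereas [idealr] only covers proper ideals. *)
Definition ideal (D : idomainType) (I : set D) : Prop :=
  [/\ I 0, forall x y, I x -> I y -> I (x + y) & forall a x, I x -> I (a * x)].

Definition fg_ideal (D : idomainType) (I : set D) : Prop :=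
  exists s : seq D, I = smallest (@ideal D) [set` s].

Definition prime_ideal (D : idomainType) (P : set D) : Prop :=
  exists Q : prime_idealr D, P = [set x | x \in Q].

Definition frac_inv (D : idomainType) (I : set {fraction D}) :
    set {fraction D} :=
  [set a | forall x, I x -> range tofrac (a * x)].

Definition GV_ideal (D : idomainType) (J : set D) : Prop :=
  [/\ fg_ideal J, J != [set 0] & frac_inv (tofrac @` J) = range tofrac].

(* Meaningful for nonzero fractional ideals [I]. *)
Definition w_envelope (D : idomainType) (I : set {fraction D}) :
    set {fraction D} :=
  [set a | exists2 J : set D, GV_ideal J & forall x, J x -> I (a * tofrac x)].

Definition w_ideal (D : idomainType) (I : set D) : Prop :=
  [/\ ideal I, I != [set 0] & w_envelope (tofrac @` I) = tofrac @` I].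

Definition maximal_w_ideal (D : idomainType) (M : set D) : Prop :=
  [/\ w_ideal M, M != setT &
      forall I : set D, w_ideal I -> I != setT -> ~ (M `<` I)].

Definition prime_w_ideal (D : idomainType) (P : set D) : Prop :=
  prime_ideal P /\ w_ideal P.

Definition w_Hilbert (D : idomainType) : Prop :=
  forall P : set D, prime_w_ideal P ->
    exists2 F : set (set D), F `<=` @maximal_w_ideal D & P = \bigcap_(M in F) M.

(* The fraction field is the subring generated by [D] and finitely many
   elements. *)
Definition G_domain (D : idomainType) : Prop :=
  exists s : seq {fraction D},
    smallest (fun S : set {fraction D} => GRing.subring_closed (mem S))
      (range tofrac `|` [set` s]) = setT.

Definition G_ideal (D : idomainType) (P : set D) : Prop :=
  exists2 Q : prime_idealr D, P = [set x | x \in Q] & G_domain (prime_quot Q).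

Definition w_G_ideal (D : idomainType) (P : set D) : Prop :=
  G_ideal P /\ w_ideal P.

(* Main.v *)
Require Import Defs.
From mathcomp Require Import all_boot all_order all_algebra.
From mathcomp Require Import boolp classical_sets.

Set Implicit Arguments.
Unset Strict Implicit.
Unset Printing Implicit Defensive.

Import GRing.Theory.
Local Open Scope ring_scope.
Local Open Scope classical_set_scope.
Local Open Scope quotient_scope.

Local Notation tofrac := (@FracField.tofrac _).

(** If [D/P] is a G-domain, some [u] outside [P] has a power in every ideal
    strictly containing [P]: lift a common denominator of ring generators of
    the fraction field.  A maximal w-ideal [M] is prime, because for [a] outside
    [M] the colon ideal [(M : a)] is a proper w-ideal containing [M].  Hence [u]
    lies in every maximal w-ideal strictly containing [P]; as [u] is not in [P],
    one of the maximal w-ideals with intersection [P] must be [P] itself. *)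

Lemma frac_denominator (D : idomainType) (x : {fraction D}) :
  exists2 d : D, d != 0 & range tofrac (x * tofrac d).
Proof.
elim/quotW: x => r; exists \d_r; first exact: denom_ratioP.
exists \n_r => //; rewrite !piE; apply/eqmodP => /=.
rewrite FracField.equivfE /FracField.mulf.
rewrite !numden_Ratio ?mulr1 ?mul1r ?oner_neq0 ?denom_ratioP //.
Qed.

Lemma frac_common_denominator (D : idomainType) (s : seq {fraction D}) :
  exists2 d : D, d != 0 & {in s, forall x, range tofrac (x * tofrac d)}.
Proof.
elim: s => [|x s [d d0 ds]]; first by exists 1 => //; exact: oner_neq0.
have [e e0 [n _ xe]] := frac_denominator x.
exists (e * d) => [|y]; first exact: mulf_neq0.
rewrite inE tofracM => /predU1P[->|/ds [m _ yd]].
  by exists (n * d) => //; rewrite tofracM xe mulrA.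
by exists (e * m) => //; rewrite tofracM yd mulrCA.
Qed.

(** A common denominator [u] of the generators puts every fraction in the form [a / u ^+ n]; for the
    inverse of [c] this gives the divisibility. *)
Lemma G_domain_pow_dvd (D : idomainType) : G_domain D ->
  exists2 u : D, u != 0 & forall c, c != 0 -> exists n d, u ^+ n = d * c.
Proof.
case=> s gen_s; have [u u0 us] := frac_common_denominator s.
exists u => // c c0.
(* [Du] is the localization [D[1/u]]: a subring containing [D] and the generators, hence the whole
   fraction field. *)
pose Du := [set x | exists n, range tofrac (x * tofrac u ^+ n)].
have Du_inv : Du (tofrac c)^-1.
  suff : [set: {fraction D}] `<=` Du by apply.
  rewrite -gen_s; apply: smallest_sub => [|x [[a _ <-]|/us xu]].
  - split; first by rewrite inE; exists 0%N; rewrite mul1r; exists 1.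
    + move=> x y /[!inE] -[m [a _ xa]] [n [b _ yb]]; exists (m + n)%N.
      exists (a * u ^+ n - b * u ^+ m) => //.
      rewrite tofracB !tofracM !tofracXn xa yb mulrBl exprD -!mulrA.
      by rewrite (mulrC (tofrac u ^+ n)).
    + move=> x y /[!inE] -[m [a _ xa]] [n [b _ yb]]; exists (m + n)%N.
      by exists (a * b) => //; rewrite tofracM xa yb exprD mulrACA.
  - by exists 0%N, a => //; rewrite mulr1.
  - by exists 1%N.
case: Du_inv => n [d _ cd]; exists n, d.
apply/eqP; rewrite -tofrac_eq tofracM cd tofracXn mulrAC mulVf ?mul1r //.
by rewrite tofrac_eq0.
Qed.

(** Lifts [G_domain_pow_dvd] from [D/P] to [D]: equalities in the quotient become congruences modulo
    [P]. *)
Lemma G_ideal_pow (D : idomainType) (P : set D) : G_ideal P ->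
  exists2 u, ~ P u & forall c, ~ P c -> exists n d, P (u ^+ n - d * c).
Proof.
case=> Q -> /G_domain_pow_dvd[].
have piQ (x : D) : (x \in Q) = (\pi_{ideal_quot Q} x == 0).
  by rewrite -[x in LHS]subr0 Quotient.idealrBE rmorph0.
elim/quotW=> u u0 pow_u; exists u => [/=|c /= /negP].
  by rewrite piQ; apply/negP.
rewrite piQ => /pow_u[n []]; elim/quotW=> d ud; exists n, d.
by rewrite piQ rmorphB rmorphM rmorphXn subr_eq0; apply/eqP.
Qed.

Lemma GV_ideal_setT (D : idomainType) : GV_ideal [set: D].
Proof.
split.
- exists [:: 1]; apply/esym/seteqP; split=> // x _ I [[_ _ IM] I1].
  by rewrite -[x]mulr1; apply/IM/I1; rewrite /= inE.
- by apply/eqP => T0; have : [set: D] 1 by []; rewrite T0; apply/eqP/oner_neq0.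
- apply/seteqP; split=> [x|_ [a _ <-] _ [b _ <-]].
    by move/(_ 1); rewrite mulr1; apply; exists 1.
  by exists (a * b) => //; rewrite tofracM.
Qed.

(** Removes fractions from the closure condition: the w-envelope of an ideal of [D] stays inside
    [D], and the trivial GV-ideal [setT] shows that it contains the ideal. *)
Lemma w_idealP (D : idomainType) (I : set D) :
  w_ideal I <-> [/\ ideal I, I != [set 0] &
    forall J b, GV_ideal J -> (forall x, J x -> I (b * x)) -> I b].
Proof.
split=> -[idI I0 Iw]; split=> //.
  move=> J b GVJ bJ; have : w_envelope (tofrac @` I) (tofrac b).
    by exists J => // x Jx; exists (b * x); [exact: bJ | exact: tofracM].
  by rewrite Iw => -[a Ia /eqP]; rewrite tofrac_eq => /eqP <-.
have [_ _ IM] := idI.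
apply/seteqP; split=> [x [J GVJ xJ]|_ [a Ia <-]]; last first.
  exists setT; first exact: GV_ideal_setT.
  by move=> x _; exists (a * x); [rewrite mulrC; exact: IM | exact: tofracM].
(* Since [x] multiplies [J] into [I], hence into [D], it lies in the inverse of [J], which is
   [D]. *)
have [b _ bx] : range tofrac x.
  have [_ _ <-] := GVJ.
  by move=> _ [y Jy <-]; have [a _ <-] := xJ _ Jy; exists a.
exists b => //; apply: (Iw J) => // y Jy; have [a Ia /eqP] := xJ _ Jy.
by rewrite -bx -tofracM tofrac_eq => /eqP <-.
Qed.

Lemma w_ideal_colon (D : idomainType) (I : set D) (a : D) :
  w_ideal I -> w_ideal [set b | I (a * b)].
Proof.
move=> /w_idealP[[I0 ID IM] In0 Iw]; apply/w_idealP; split=> [||J b GVJ bJ].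
- split=> /= [|x y Ix Iy|b x Ix]; first by rewrite mulr0.
    by rewrite mulrDr; exact: ID.
  by rewrite mulrCA; exact: IM.
(* The colon ideal contains [I], so it vanishes only if [I] does. *)
- apply: contra_neq In0 => Ia0; apply/seteqP; split=> [x Ix|_ -> //].
  by rewrite -Ia0; exact: IM.
- by apply: (Iw J) => // x Jx; rewrite -mulrA; exact: bJ.
Qed.

Lemma maximal_w_ideal_prime (D : idomainType) (M : set D) (a b : D) :
  maximal_w_ideal M -> M (a * b) -> M a \/ M b.
Proof.
case=> Mw _ Mmax Mab; have [Ma|nMa] := pselect (M a); [by left | right].
have [[_ _ MM] _ _] := Mw.
have aMT : [set x | M (a * x)] != setT.
  apply/eqP => aMT; apply: nMa; rewrite -[a]mulr1.
  by have : [set: D] 1 by []; rewrite -aMT.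
have MaM : M `<=` [set x | M (a * x)] by move=> x; exact: MM.
(* If [b] were outside [M], it would witness that the colon ideal strictly contains [M]. *)
apply: contrapT => nMb; apply: (Mmax _ (w_ideal_colon a Mw) aMT).
by split=> // aMM; apply/nMb/aMM.
Qed.

Lemma maximal_w_ideal_exp (D : idomainType) (M : set D) (u : D) n :
  maximal_w_ideal M -> M (u ^+ n) -> M u.
Proof.
move=> Mmax; have [[[_ _ MM] _ _] MT _] := Mmax.
elim: n => [M1|n IHn]; first by rewrite -[u]mulr1; exact: MM.
by rewrite exprS => /(maximal_w_ideal_prime Mmax)[].
Qed.

Theorem proposition2p4 (D : idomainType) (hD : w_Hilbert D)
  (P : set D) (hP : w_G_ideal P) : maximal_w_ideal P.
Proof.
have [GP wP] := hP; have [u nPu pow_u] := G_ideal_pow GP.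
have Pprime : prime_w_ideal P by split=> //; case: GP => Q ->; exists Q.
have [F Fmax PF] := hD _ Pprime.
(* Either some member of [F] lies inside [P] and so equals it, or all members strictly contain [P],
   which forces [u] into their intersection [P]. *)
have [[M FM MP]|noM] := pselect (exists2 M, F M & M `<=` P).
  suff -> : P = M by exact: Fmax.
  by apply/seteqP; split=> // x; rewrite PF; apply.
case: nPu; rewrite PF => M FM; have Mmax := Fmax _ FM.
have [c Mc nPc] : exists2 c, M c & ~ P c.
  apply: contrapT => noc; apply: noM; exists M => // x Mx.
  by apply: contrapT => nPx; apply: noc; exists x.
have [n [d]] := pow_u _ nPc; rewrite PF => /(_ _ FM) Mud.
have [[[_ MD MM] _ _] _ _] := Mmax.
apply: (@maximal_w_ideal_exp _ _ _ n Mmax).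
by rewrite -(subrK (d * c) (u ^+ n)); apply: MD => //; exact: MM.
Qed.
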